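(* Assume that $\mathcal{L}$ has a saddle point $(\xi^*,y^* )\in Z\times Y$. Let $\tau>0$, $\sigma>0$ and $0<\theta\le 1$ satisfy $$\max\left\{\frac{1}{\tau\tilde\gamma+1},\frac{1}{\sigma\tilde\delta+1}\right\}\le\theta\le\frac{1}{L_K^2\tau\sigma},$$ and let $(\xi_n,y_n)_n$ be generated by the overrelaxed primal-dual algorithm described in the context with these parameters. Then, for any $\omega$ such that $$\max\left\{\frac{1}{\tau\tilde\gamma+1},\frac{\theta+1}{\sigma\tilde\delta+2}\right\}\le\omega\le\theta,$$ the following hold. (i) For any $N\in\mathbb{N}$ and any $(\xi,y)\in Z\times Y$, $$\frac{1}{2\tau}\|\xi_N-\xi\|^2+(1-\omega L_K^2\tau\sigma)\frac{1}{2\sigma}\|y_N-y\|^2+\sum_{n=1}^N\frac{\omega^N}{\omega^{n-1}}\big(\mathcal{L}(\xi_n;y)-\mathcal{L}(\xi;y_n)\big)\le\frac{\omega^N}{2\tau}\|\xi_0-\xi\|^2+\frac{\omega^N}{2\sigma}\|y_0-y\|^2.$$ (ii) For $N\ge 1$ define $$T_N:=\sum_{n=1}^N\frac{1}{\omega^{n-1}}=\frac{1-\omega^N}{\omega^{N-1}(1-\omega)},\qquad \Xi_N:=\frac{1}{T_N}\sum_{n=1}^N\frac{1}{\omega^{n-1}}\,\xi_n,\qquad Y_N:=\frac{1}{T_N}\sum_{n=1}^N\frac{1}{\omega^{n-1}}\,y_n.$$ Then for any $(\xi,y)\in Z\times Y$, $$\frac{1-\omega}{\omega(1-\omega^N)}\frac{1}{2\tau}\|\xi-\xi_N\|^2+\frac{1-\omega}{\omega(1-\omega^N)}(1-\omega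 L_K^2\tau\sigma)\frac{1}{2\sigma}\|y-y_N\|^2+\mathcal{L}(\Xi_N;y)-\mathcal{L}(\xi;Y_N)\le\frac{1}{T_N}\frac{1}{2\tau}\|\xi-\xi_0\|^2+\frac{1}{T_N}\frac{1}{2\sigma}\|y-y_0\|^2.$$ If $\omega=1$, then $T_N$ is understood as $N$ and $\frac{1-\omega}{\omega(1-\omega^N)}$ as its limit value $\frac1N$.
   Context: $Z$ and $Y$ are finite-dimensional real Hilbert spaces; $K:Z\to Y$ is a linear operator with adjoint $K^*$ and operator norm $L_K=\|K\|>0$. $G:Z\to\mathbb{R}\cup\{+\infty\}$ and $H:Y\to\mathbb{R}\cup\{+\infty\}$ are proper, convex and lower semicontinuous; $H^*$ is the convex conjugate of $H$. $G$ is $\tilde\gamma$-strongly convex and $H^*$ is $\tilde\delta$-strongly convex, with $\tilde\gamma,\tilde\delta>0$ (a function $F$ is $\alpha$-strongly convex if $F(x_2)\ge F(x_1)+\langle p,x_2-x_1\rangle+\frac{\alpha}{2}\|x_2-x_1\|^2$ for all $x_1,x_2$ and $p\in\partial F(x_1)$). $\mathcal{L}(\xi;y):=G(\xi)+\langle K\xi,y\rangle-H^*(y)$ for $(\xi,y)\in Z\times Y$. A saddle point of $\mathcal{L}$ is a solution $(\xi^*,y^* )$ of $\min_{\xi\in Z}\sup_{y\in Y}\mathcal{L}(\xi;y)$ with $\mathcal{L}(\xi^*;y)\le\mathcal{L}(\xi^*;y^* )\le\mathcal{L}(\xi;y^* )$ for all $(\xi,y)$. For proper convex lower semicontinuous $F$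 and $t>0$, $\mathrm{prox}_{tF}(v)=\arg\min_u\{F(u)+\frac{1}{2t}\|u-v\|^2\}$. Algorithm (overrelaxed PDHG): given $\xi_0\in Z$, $y_0\in Y$ and $\bar\xi_0=\xi_0$, for $n\ge 0$, $$y_{n+1}=\mathrm{prox}_{\sigma H^*}(y_n+\sigma K\bar\xi_n),\quad \xi_{n+1}=\mathrm{prox}_{\tau G}(\xi_n-\tau K^*y_{n+1}),\quad \bar\xi_{n+1}=\xi_{n+1}+\theta(\xi_{n+1}-\xi_n).$$ *)

(* Defs.v *)
From HB Require Import structures.
From mathcomp Require Export all_boot all_order all_algebra.
From mathcomp Require Export boolp classical_sets reals ereal.
From mathcomp Require Export topology normedtype.

Set Implicit Arguments.
Unset Strict Implicit.
Unset Printing Implicit Defensive.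

Import Order.TTheory GRing.Theory Num.Theory.
Import numFieldNormedType.Exports.

Local Open Scope classical_set_scope.
Local Open Scope ring_scope.

(* Finite dimension comes from [Vector]; completeness is then automatic.  The
   norm of [NormedModule] is required to be the one induced by the inner
   product (so the sup-normed ['rV[R]_n] is not, as such, an instance). *)
HB.mixin Record isInnerProductSpace (R : realType) E
    of Vector R E & NormedModule R E := {
  inner : {dot E for idfun};
  sqr_norm_inner : forall x : E, `|x| ^+ 2 = inner x x
}.

#[short(type="finHilbertType")]
HB.structure Definition FinHilbert (R : realType) :=
  {E of Vector R E & NormedModule R E & isInnerProductSpace R E}.

Notation "''[' x , y ]" := (inner x%R y%R) : ring_scope.
Notation "''[' x , y ]" := (inner x%R y%R) : ereal_scope.

Section Operators.
Context {R : realType} {Z Y : finHilbertType R}.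

Definition opnorm (K : {linear Z -> Y}) : R :=
  sup [set `|K x| | x in [set x : Z | `|x| <= 1]].

Definition is_adjoint (K : {linear Z -> Y}) (Kstar : {linear Y -> Z}) : Prop :=
  forall x y, '[K x, y] = '[x, Kstar y].

End Operators.

Section ConvexAnalysis.
Context {R : realType} {E : finHilbertType R}.
Implicit Types (F : E -> \bar R) (x y p u v : E) (t alpha : R).
Local Open Scope ereal_scope.

(* With [proper_efun], an [\bar R]-valued function is one into R `|` {+oo}. *)
Definition proper_efun F : Prop :=
  (forall x, F x != -oo) /\ (exists x, F x != +oo).

(* [convex_function] of the library only covers real-valued functions.  At
   [t = 0] and [t = 1] the convention [0 * +oo = 0] makes this trivial. *)
Definition convex_efun F : Prop := forall x y t, (0 <= t <= 1)%R ->
  F (t *: x + (1 - t) *: y)%R <= t%:E * F x + (1 - t)%:E * F y.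

Definition subdifferential F x : set E :=
  [set p | forall z, F x + '[p, z - x]%:E <= F z].

Definition strongly_convex alpha F : Prop := forall x1 x2 p,
  subdifferential F x1 p ->
  F x1 + ('[p, x2 - x1] + alpha / 2 * `|x2 - x1| ^+ 2)%:E <= F x2.

Definition conjugate F : E -> \bar R :=
  fun p => ereal_sup [set '[x, p]%:E - F x | x in [set: E]].

(* The set of minimizers, which is a singleton when [F] is proper, convex and
   lower semicontinuous and [0 < t]. *)
Definition prox t F v : set E :=
  [set u | forall w, F u + (1 / (2 * t) * `|u - v| ^+ 2)%:E <=
                     F w + (1 / (2 * t) * `|w - v| ^+ 2)%:E].

End ConvexAnalysis.

Section SaddlePoint.
Context {R : realType} {Z Y : finHilbertType R}.
Local Open Scope ereal_scope.

(* [adde] sets [+oo - +oo = -oo]; for proper [G] and [conjugate H] this case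
   occurs only when [G xi = +oo] and [conjugate H y = +oo]. *)
Definition lagrangian (G : Z -> \bar R) (H : Y -> \bar R) (K : {linear Z -> Y})
    (xi : Z) (y : Y) : \bar R :=
  G xi + '[K xi, y]%:E - conjugate H y.

Definition saddle_point (L : Z -> Y -> \bar R) (xis : Z) (ys : Y) : Prop :=
  [/\ forall xi, ereal_sup (range (L xis)) <= ereal_sup (range (L xi)),
      L xis ys = ereal_sup (range (L xis)) &
      forall xi y, L xis y <= L xis ys /\ L xis ys <= L xi ys].

End SaddlePoint.

Section Algorithm.
Context {R : realType} {Z Y : finHilbertType R}.

Definition overrelaxed_pdhg (G : Z -> \bar R) (H : Y -> \bar R)
    (K : {linear Z -> Y}) (Kstar : {linear Y -> Z}) (tau sigma theta : R)
    (xi : nat -> Z) (y : nat -> Y) (xibar : nat -> Z) : Prop :=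
  xibar 0%N = xi 0%N /\
  forall n,
    [/\ prox sigma (conjugate H) (y n + sigma *: K (xibar n)) (y n.+1),
        prox tau G (xi n - tau *: Kstar (y n.+1)) (xi n.+1) &
        xibar n.+1 = xi n.+1 + theta *: (xi n.+1 - xi n)].

End Algorithm.

Section ErgodicAverage.
Context {R : realType}.

Definition weight_sum (omega : R) (N : nat) : R :=
  \sum_(1 <= n < N.+1) 1 / omega ^+ n.-1.

Definition ergodic_average {E : lmodType R} (omega : R) (N : nat)
    (u : nat -> E) : E :=
  (1 / weight_sum omega N) *:
    \sum_(1 <= n < N.+1) (1 / omega ^+ n.-1) *: u n.

Definition ergodic_factor (omega : R) (N : nat) : R :=
  if omega == 1 then 1 / N%:R
  else (1 - omega) / (omega * (1 - omega ^+ N)).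

End ErgodicAverage.

(* Main.v *)
Require Import Defs.
From mathcomp Require Import ring lra.

Set Implicit Arguments.
Unset Strict Implicit.
Unset Printing Implicit Defensive.

Import Order.TTheory GRing.Theory Num.Theory.
Import numFieldNormedType.Exports.

Local Open Scope classical_set_scope.
Local Open Scope ring_scope.

(* Optimality of the two proximal steps together with strong convexity bounds
   the gap L(xi_{n+1}; y) - L(xi; y_{n+1}) by differences of squared distances
   plus the coupling <K (xi_{n+1} - xibar_n), y - y_{n+1}>.  Splitting the
   extrapolation weight as theta = omega + (theta - omega) and using Young's
   inequality with parameter omega / (theta tau) absorbs the coupling, so that
   an energy E_n satisfies gap_{n+1} + E_{n+1} / omega <= E_n.  Part (i) is the
   weighted telescoping sum of these; part (ii) divides (i) by omega^N T_N and
   applies Jensen's inequality.  If G xi or H^* y is infinite, every gap is -oo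
   and the bounds are trivial. *)

(** * Inner product identities and Young's inequality *)

Section InnerProduct.
Context {R : realType} {E : finHilbertType R}.
Implicit Types (x y z : E) (a : R).

Lemma innerC x y : '[x, y] = '[y, x].
Proof. by rewrite hermC /= expr0 mul1r. Qed.

Lemma innerDl x y z : '[x + y, z] = '[x, z] + '[y, z].
Proof. exact: linearDl. Qed.

Lemma innerDr x y z : '[z, x + y] = '[z, x] + '[z, y].
Proof. by rewrite innerC innerDl !(innerC z). Qed.

Lemma innerZl a x z : '[a *: x, z] = a * '[x, z].
Proof. exact: linearZl_LR. Qed.

Lemma innerZr a x z : '[z, a *: x] = a * '[z, x].
Proof. by rewrite innerC innerZl innerC. Qed.

Lemma innerBl x y z : '[x - y, z] = '[x, z] - '[y, z].
Proof. exact: linearBl. Qed.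

Lemma innerBr x y z : '[z, x - y] = '[z, x] - '[z, y].
Proof. by rewrite innerC innerBl !(innerC z). Qed.

Lemma innerNl x z : '[- x, z] = - '[x, z].
Proof. exact: linearNl. Qed.

Lemma innerNr x z : '[z, - x] = - '[z, x].
Proof. by rewrite innerC innerNl innerC. Qed.

Lemma sqr_normD x y : `|x + y| ^+ 2 = `|x| ^+ 2 + 2 * '[x, y] + `|y| ^+ 2.
Proof. rewrite !sqr_norm_inner innerDl !innerDr (innerC y x); ring. Qed.

Lemma sqr_normB x y : `|x - y| ^+ 2 = `|x| ^+ 2 - 2 * '[x, y] + `|y| ^+ 2.
Proof. rewrite !sqr_norm_inner innerBl !innerBr (innerC y x); ring. Qed.

(** Expand the squared norms of [a *: x - y] and [a *: x + y], both nonnegative, and divide by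
    [2 * a]; the two signs give the absolute value. *)
Lemma inner_young x y a : 0 < a ->
  `|'[x, y]| <= a / 2 * `|x| ^+ 2 + a^-1 / 2 * `|y| ^+ 2.
Proof.
move=> a0.
have := exprn_ge0 2 (normr_ge0 (a *: x + y)).
have := exprn_ge0 2 (normr_ge0 (a *: x - y)).
rewrite sqr_normB sqr_normD innerZl normrZ gtr0_norm // exprMn => h1 h2.
have -> : a / 2 * `|x| ^+ 2 + a^-1 / 2 * `|y| ^+ 2 =
    (a ^+ 2 * `|x| ^+ 2 + `|y| ^+ 2) / (2 * a).
  by field; apply: lt0r_neq0.
rewrite ler_pdivlMr ?mulr_gt0 //.
rewrite -[2 * a in X in X <= _]gtr0_norm ?mulr_gt0 // -normrM ler_norml.
by apply/andP; split; lra.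
Qed.

End InnerProduct.

(** * The operator norm as a Lipschitz bound *)

Section Operators.
Context {R : realType} {Z Y : finHilbertType R}.

(* An unbounded [K] would have [opnorm K = 0], the junk value of [sup]. *)
Lemma opnorm_ub (K : {linear Z -> Y}) (x : Z) : 0 < opnorm K ->
  `|K x| <= opnorm K * `|x|.
Proof.
move=> K0.
have [->|x0] := eqVneq x 0; first by rewrite linear0 !normr0 mulr0.
have x0' : 0 < `|x| by rewrite normr_gt0.
have hs : has_sup [set `|K x| | x in [set x : Z | `|x| <= 1]].
  by apply: contrapT => /sup_out h; move: K0; rewrite /opnorm h ltxx.
have : `|K (`|x|^-1 *: x)| <= opnorm K.
  apply: (sup_upper_bound hs); exists (`|x|^-1 *: x) => //=.
  by rewrite normrZ normfV normr_id mulVf // gt_eqF.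
by rewrite linearZ /= normrZ normfV normr_id mulrC ler_pdivrMr.
Qed.

(** Young's inequality for [K x] and [y] is taken with parameter [a / opnorm K ^+ 2], so that
    [opnorm_ub] leaves exactly [a / 2] in front of the square of [x]. *)
Lemma inner_linear_young (K : {linear Z -> Y}) (x : Z) (y : Y) (a : R) :
  0 < opnorm K -> 0 < a ->
  `|'[K x, y]| <= a / 2 * `|x| ^+ 2 + opnorm K ^+ 2 / a / 2 * `|y| ^+ 2.
Proof.
move=> K0 a0.
have b0 : 0 < a / opnorm K ^+ 2 by rewrite divr_gt0 ?exprn_gt0.
apply: (le_trans (inner_young (K x) y b0)).
rewrite invf_div lerD2r.
have : `|K x| ^+ 2 <= opnorm K ^+ 2 * `|x| ^+ 2.
  by rewrite -exprMn lerXn2r ?nnegrE ?mulr_ge0 ?(ltW K0) // opnorm_ub.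
rewrite -(ler_pM2l (divr_gt0 b0 (ltr0n R 2))) => /le_trans; apply.
by rewrite le_eqVlt; apply/orP; left; apply/eqP; field; apply: lt0r_neq0.
Qed.

End Operators.

(** * Jensen's inequality, conjugates and proximal points *)

Section ConvexAnalysis.
Context {R : realType} {E : finHilbertType R}.
Implicit Types (F : E -> \bar R) (u v x y z : E).

Lemma convex_efun_le F x y t (a b : R) : convex_efun F -> 0 <= t <= 1 ->
  (F x <= a%:E)%E -> (F y <= b%:E)%E ->
  (F (t *: x + (1 - t) *: y)%R <= (t * a + (1 - t) * b)%:E)%E.
Proof.
move=> Fc t01 Fa Fb; apply: (le_trans (Fc _ _ _ t01)).
case/andP: t01 => t0 t1.
by rewrite [leRHS]EFinD !EFinM leeD // lee_wpmul2l // lee_fin // subr_ge0.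
Qed.

Lemma convex_efun_jensen F (u : nat -> E) (f w : nat -> R) (N : nat) :
  convex_efun F -> (1 <= N)%N -> (forall n, 0 < w n) ->
  (forall n, (1 <= n <= N)%N -> (F (u n) <= (f n)%:E)%E) ->
  let T := \sum_(1 <= n < N.+1) w n in
  (F (T^-1 *: \sum_(1 <= n < N.+1) w n *: u n)%R
    <= (T^-1 * \sum_(1 <= n < N.+1) w n * f n)%:E)%E.
Proof.
move=> Fc + w0.
have T0 M : (1 <= M)%N -> 0 < \sum_(1 <= n < M.+1) w n.
  move=> M1; rewrite big_nat_recr //= ltr_wpDl //.
  by rewrite sumr_ge0 // => n _; rewrite ltW.
elim: N => // -[|N] IH _ Ff /=.
  rewrite !big_nat1 scalerA mulrA mulVf ?scale1r ?mul1r; last exact: lt0r_neq0.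
  exact: Ff.
have {IH} Fle := IH isT _.
rewrite !(big_nat_recr N.+2) //=.
have T0N := T0 N.+1 isT.
set T := \sum_(1 <= n < N.+2) w n in T0N Fle *.
set S := \sum_(1 <= n < N.+2) _ in Fle *.
set s := \sum_(1 <= n < N.+2) _ in Fle *.
have TS0 : 0 < T + w N.+2 by rewrite addr_gt0.
(* The longer average is a convex combination of the shorter average and the new point. *)
have -> : (T + w N.+2)^-1 *: (S + w N.+2 *: u N.+2) =
    (T / (T + w N.+2)) *: (T^-1 *: S) + (1 - T / (T + w N.+2)) *: u N.+2.
  rewrite scalerDr !scalerA; congr (_ *: _ + _ *: _);
    by field; rewrite ?lt0r_neq0.
have -> : (T + w N.+2)^-1 * (s + w N.+2 * f N.+2) =
    (T / (T + w N.+2)) * (T^-1 * s) + (1 - T / (T + w N.+2)) * f N.+2.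
  by field; rewrite ?lt0r_neq0.
apply: convex_efun_le => //.
- by rewrite ler_pdivrMr // mul1r lerDl (ltW (w0 _)) divr_ge0 // ltW.
- by apply: Fle => n /andP[n1 nN]; rewrite Ff // n1 leqW.
- by apply: Ff; rewrite /= ltnSn.
Qed.

(** A point where [F] is finite contributes a real term to the supremum. This is one half of
    properness; the other half is obtained in [theorem1] from a point where the conjugate is
    finite. *)
Lemma conjugate_neqNy F : proper_efun F -> forall p, conjugate F p != -oo%E.
Proof.
move=> [FN [x0 Fx0]] p; rewrite -ltNye.
apply: (@lt_le_trans _ _ ('[x0, p]%:E - F x0)%E).
  by move: (FN x0) Fx0; case: (F x0) => // r _ _; rewrite ltNyr.
by apply: ereal_sup_ubound; exists x0.
Qed.

(** The conjugate is a supremum of functions affine in [p]; points with [F x = +oo] only contribute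
    [-oo]. *)
Lemma convex_conjugate F : proper_efun F -> convex_efun (conjugate F).
Proof.
move=> [FN _] p q t /andP[t0 t1]; apply: ge_ereal_sup => _ [x _ <-].
case Fx : (F x) => [r| |]; last by move: (FN x); rewrite Fx.
  have -> : ('[x, t *: p + (1 - t) *: q]%:E - r%:E =
      t%:E * ('[x, p]%:E - r%:E) + (1 - t)%:E * ('[x, q]%:E - r%:E))%E.
    by rewrite -!EFinB -!EFinM -EFinD innerDr !innerZr; congr EFin; ring.
  rewrite leeD // lee_wpmul2l ?lee_fin ?subr_ge0 //;
    by apply: ereal_sup_ubound; exists x => //; rewrite Fx.
by rewrite addeNy leNye.
Qed.

Lemma prox_fin_num t F v u : proper_efun F -> prox t F v u ->
  F u \is a fin_num.
Proof.
move=> [FN [x0 Fx0]] /(_ x0); rewrite fin_numE FN /=.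
by move: (FN x0) Fx0; case: (F x0) => // r _ _; case: (F u).
Qed.

(** Fermat's rule: if the subgradient inequality failed at [z], a short move from [u] towards [z]
    would lower the proximal objective. *)
Lemma prox_subdifferential t F v u : proper_efun F -> convex_efun F -> 0 < t ->
  prox t F v u -> subdifferential F u (t^-1 *: (v - u)).
Proof.
move=> Fp Fc t0 uprox z.
have /fineK := prox_fin_num Fp uprox; move: (fine _) => a Fu.
rewrite /= -Fu; case Fz : (F z) => [b| |]; first last.
- by have [/(_ z)] := Fp; rewrite Fz.
- exact: leey.
rewrite -EFinD lee_fin innerZl -subr_ge0.
set A := b - _; rewrite leNgt; apply/negP => A0.
pose c := t^-1 / 2 * `|z - u| ^+ 2.
have c0 : 0 <= c by rewrite mulr_ge0 ?exprn_ge0 // divr_ge0 // invr_ge0 ltW.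
(* A move by [s] changes the objective by at most [s * (A + c * s)], where [A < 0] is the defect in
   the subgradient inequality. This [s] is at most 1 and keeps [A + c * s] negative. *)
pose s := - A / (c - A).
have cA0 : 0 < c - A by lra.
have s0 : 0 < s by rewrite divr_gt0 // oppr_gt0.
have s1 : s <= 1 by rewrite ler_pdivrMr // mul1r lerBrDr addNr.
have : (F (s *: z + (1 - s) *: u)%R <= (s * b + (1 - s) * a)%:E)%E.
  by apply: convex_efun_le; rewrite ?Fz -?Fu ?(ltW s0).
have := uprox (s *: z + (1 - s) *: u); rewrite -Fu.
have -> : s *: z + (1 - s) *: u - v = s *: (z - u) + (u - v).
  by rewrite scalerBl scale1r scalerBr addrA addrACA addrA addrAC.
move: (F _) => Fw h1 h2; have := le_trans h1 (leeD2r _ h2).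
rewrite -!EFinD lee_fin (sqr_normD (s *: _)) innerZl normrZ exprMn gtr0_norm //.
have -> : '[z - u, u - v] = - '[v - u, z - u].
  by rewrite innerC -(opprB v u) innerNl.
have h : 0 < s * (- A - c * s).
  rewrite mulr_gt0 // subr_gt0 /s mulrA ltr_pdivrMr //.
  by rewrite mulrBr mulrC ltrDl; nra.
move: h; rewrite /A /c.
have -> : 1 / (2 * t) = t^-1 / 2 by field; apply: lt0r_neq0.
lra.
Qed.

Lemma prox_strongly_convex t alpha F v u z :
  proper_efun F -> convex_efun F -> strongly_convex alpha F -> 0 < t ->
  prox t F v u ->
  (F u + (t^-1 * '[v - u, z - u] + alpha / 2 * `|z - u| ^+ 2)%:E <= F z)%E.
Proof.
move=> Fp Fc Fs t0 uprox; rewrite -innerZl.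
by apply: Fs; apply: prox_subdifferential.
Qed.

End ConvexAnalysis.

(** * Geometric weights and weighted averages *)

Section Weights.
Context {R : realType}.
Implicit Types (omega : R) (gap e : nat -> R) (N : nat).

Lemma weighted_telescope omega gap e N : 0 < omega ->
  (forall n, gap n.+1 + omega^-1 * e n.+1 <= e n) ->
  \sum_(1 <= n < N.+1) omega ^+ N / omega ^+ n.-1 * gap n + e N
    <= omega ^+ N * e 0%N.
Proof.
move=> w0 step; elim: N => [|N IH]; first by rewrite big_nil add0r expr0 mul1r.
rewrite big_nat_recr //= exprS mulfK ?expf_neq0 ?lt0r_neq0 //.
under eq_bigr do rewrite -!mulrA; rewrite -mulr_sumr.
under eq_bigr do rewrite mulrA.
(* The newest gap has weight [omega], so [omega] factors out of every term and [step] reduces the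
   claim to the induction hypothesis. *)
rewrite -[e N.+1](mulVKf (lt0r_neq0 w0)) -addrA -!mulrDr -mulrA ler_pM2l //.
by apply: le_trans IH; rewrite lerD2l.
Qed.

Lemma weight_sum_gt0 omega N : 0 < omega -> (1 <= N)%N ->
  0 < weight_sum omega N.
Proof.
move=> w0; case: N => // N _; rewrite /weight_sum big_nat_recr //=.
rewrite ltr_wpDl ?sumr_ge0 // => [n _|].
  by rewrite divr_ge0 // exprn_ge0 // ltW.
by rewrite divr_gt0 // exprn_gt0.
Qed.

Lemma weight_sumE omega N : 0 < omega -> (1 <= N)%N ->
  weight_sum omega N = if omega == 1 then N%:R
    else (1 - omega ^+ N) / (omega ^+ N.-1 * (1 - omega)).
Proof.
move=> w0 N1; rewrite /weight_sum; case: eqVneq => [->|w1].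
  under eq_bigr do rewrite expr1n divr1.
  by rewrite big_const_nat iter_addr_0 subn1.
have {}w1 : 1 - omega != 0 by rewrite subr_eq0 eq_sym.
have wn n : omega ^+ n != 0 by rewrite expf_neq0 ?lt0r_neq0.
elim: N N1 => // -[_ _|N IH _].
  by rewrite big_nat1 !expr0 expr1 divr1 mul1r mulfV.
rewrite big_nat_recr //= IH //= !exprS.
by field; rewrite w1 wn lt0r_neq0.
Qed.

(** This identifies the prefactor of part (ii) as the number by which part (i) has to be multiplied,
    in the limit case [omega = 1] as well. *)
Lemma ergodic_factorE omega N : 0 < omega <= 1 -> (1 <= N)%N ->
  ergodic_factor omega N = (omega ^+ N * weight_sum omega N)^-1.
Proof.
move=> /andP[w0 w1] N1; rewrite weight_sumE // /ergodic_factor.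
case: eqVneq => [->|wn1]; first by rewrite expr1n !mul1r.
have {}w1 : omega < 1 by rewrite lt_neqAle wn1.
case: N N1 => // N _ /=.
have h : 1 - omega ^+ N.+1 != 0.
  by rewrite subr_eq0 eq_sym lt_eqF // exprn_ilt1 // ltW.
move: h; rewrite exprS => h.
by field; rewrite h subr_eq0 eq_sym wn1 expf_neq0 ?lt0r_neq0 //.
Qed.

(** Finiteness is asked from index 1 on only: later iterates are proximal points, whereas the
    function may be [+oo] at the starting point. *)
Lemma convex_ergodic_average_le {E : finHilbertType R} (F : E -> \bar R)
    omega N (u : nat -> E) (f : nat -> R) :
  0 < omega -> (1 <= N)%N -> convex_efun F ->
  (forall n, F (u n.+1) = (f n.+1)%:E) ->
  (F (ergodic_average omega N u) <= ((weight_sum omega N)^-1 *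
    \sum_(1 <= n < N.+1) 1 / omega ^+ n.-1 * f n)%:E)%E.
Proof.
move=> w0 N1 Fc Ff; rewrite /ergodic_average div1r.
apply: convex_efun_jensen => // [n|[//|n] _].
  by rewrite divr_gt0 // exprn_gt0.
by rewrite Ff.
Qed.

End Weights.

(** * Extended-real Lagrangian gaps *)

Section Lagrangian.
Context {R : realType} {Z Y : finHilbertType R}.
Variables (G : Z -> \bar R) (H : Y -> \bar R) (K : {linear Z -> Y}).
Let L := lagrangian G H K.

(* With [+oo - +oo = -oo] the gap is [-oo] as soon as the comparison point
   leaves the domain of [G] or of [conjugate H]. *)
Lemma lagrangian_gapNy (a xi : Z) (y b : Y) :
  conjugate H y = +oo%E \/ (G xi = +oo%E /\ conjugate H b != +oo%E) ->
  (L a y - L xi b = -oo)%E.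
Proof.
rewrite /L /lagrangian => -[->|[-> Hb]]; first by rewrite /= addeNy addNye.
rewrite addye // ?addeNy //.
by move: Hb; case: (conjugate H b).
Qed.

(** [G a] and [conjugate H b] enter the gap with a positive sign, so upper bounds suffice; for
    ergodic averages Jensen's inequality gives nothing more. *)
Lemma lagrangian_gap_le (a xi : Z) (y b : Y) (ga gx hb hy : R) :
  (G a <= ga%:E)%E -> G xi = gx%:E ->
  (conjugate H b <= hb%:E)%E -> conjugate H y = hy%:E ->
  (L a y - L xi b
    <= ((ga + '[K a, y] - hy) - (gx + '[K xi, b] - hb))%:E)%E.
Proof.
move=> Ga Gx Hb Hy; rewrite /L /lagrangian Gx Hy.
rewrite [leRHS]EFinB leeB // EFinB EFinD; first by rewrite leeB // leeD.
by rewrite -EFinD leeB.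
Qed.

Lemma lagrangian_gapE (a xi : Z) (y b : Y) (ga gx hb hy : R) :
  G a = ga%:E -> G xi = gx%:E ->
  conjugate H b = hb%:E -> conjugate H y = hy%:E ->
  (L a y - L xi b
    = ((ga + '[K a, y] - hy) - (gx + '[K xi, b] - hb))%:E)%E.
Proof. by rewrite /L /lagrangian => -> -> -> ->. Qed.

(** Jensen's inequality handles [G] and [conjugate H]; the pairings are linear in the averages, and
    the constants [gx] and [hy] carry the total weight, so the rest is an equality. *)
Lemma ergodic_lagrangian_gap_le (omega : R) (N : nat) (x : nat -> Z)
    (y : nat -> Y) (g h : nat -> R) (xi : Z) (eta : Y) (gx hy : R) :
  0 < omega -> (1 <= N)%N ->
  convex_efun G -> convex_efun (conjugate H) ->
  (forall n, G (x n.+1) = (g n.+1)%:E) ->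
  (forall n, conjugate H (y n.+1) = (h n.+1)%:E) ->
  G xi = gx%:E -> conjugate H eta = hy%:E ->
  (L (ergodic_average omega N x) eta - L xi (ergodic_average omega N y)
    <= ((weight_sum omega N)^-1 * \sum_(1 <= n < N.+1) 1 / omega ^+ n.-1 *
         ((g n + '[K (x n), eta] - hy) - (gx + '[K xi, y n] - h n)))%:E)%E.
Proof.
move=> w0 N1 Gc Hc Gg Hh Gx Hy.
have GT := convex_ergodic_average_le w0 N1 Gc Gg.
have HT := convex_ergodic_average_le w0 N1 Hc Hh.
apply: le_trans (lagrangian_gap_le GT Gx HT Hy) _.
rewrite lee_fin le_eqVlt; apply/orP; left; apply/eqP.
have T0 := weight_sum_gt0 w0 N1.
rewrite /ergodic_average div1r [K (_ *: _)]linearZ /= (linear_sum K)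
  (innerZl (weight_sum omega N)^-1).
rewrite (innerZr (weight_sum omega N)^-1) linear_sumlz linear_sumr.
have -> : \sum_(1 <= n < N.+1) '[K ((1 / omega ^+ n.-1) *: x n), eta] =
    \sum_(1 <= n < N.+1) 1 / omega ^+ n.-1 * '[K (x n), eta].
  by apply: eq_bigr => n _; rewrite [K (_ *: _)]linearZ /= innerZl.
have -> : \sum_(1 <= n < N.+1) '[K xi, (1 / omega ^+ n.-1) *: y n] =
    \sum_(1 <= n < N.+1) 1 / omega ^+ n.-1 * '[K xi, y n].
  by apply: eq_bigr => n _; rewrite innerZr.
have -> : \sum_(1 <= n < N.+1) 1 / omega ^+ n.-1 *
      ((g n + '[K (x n), eta] - hy) - (gx + '[K xi, y n] - h n)) =
    \sum_(1 <= n < N.+1) 1 / omega ^+ n.-1 * g n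
    + \sum_(1 <= n < N.+1) 1 / omega ^+ n.-1 * '[K (x n), eta]
    - \sum_(1 <= n < N.+1) 1 / omega ^+ n.-1 * '[K xi, y n]
    + \sum_(1 <= n < N.+1) 1 / omega ^+ n.-1 * h n
    - weight_sum omega N * (hy + gx).
  rewrite /weight_sum mulr_suml -!sumrN -!big_split /=.
  by apply: eq_bigr => n _; ring.
by field; exact: lt0r_neq0.
Qed.

End Lagrangian.

(** * Energy decrease along one iteration *)

Section OneStep.
Context {R : realType} {Z Y : finHilbertType R}.
Variables (K : {linear Z -> Y}) (Kstar : {linear Y -> Z}).
Hypotheses (hKstar : is_adjoint K Kstar) (hK : 0 < opnorm K).
Variables (gamma delta tau sigma theta omega : R).
Hypotheses (htau : 0 < tau) (hsigma : 0 < sigma).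
Hypotheses (homega : 0 < omega) (homegau : omega <= theta).
Hypotheses (hprimal : 1 <= omega * (tau * gamma + 1))
  (hdual : theta + 1 <= omega * (sigma * delta + 2))
  (hstep : theta * (opnorm K ^+ 2 * tau * sigma) <= 1).

(* [x0], [x1] are the previous and the current primal iterate; the algorithm
   starts with [x0 = x1]. *)
Definition pdhg_energy (x x0 x1 : Z) (y y1 : Y) : R :=
  tau^-1 / 2 * `|x1 - x| ^+ 2 + sigma^-1 / 2 * `|y1 - y| ^+ 2
  + omega * '[K (x1 - x0), y1 - y]
  + omega * (tau^-1 / 2 * `|x1 - x0| ^+ 2).

(** Young's inequality with parameter [tau^-1] bounds the pairing in the energy: its primal part
    cancels the square of [x1 - x0], its dual part produces the factor
    [1 - omega * opnorm K ^+ 2 * tau * sigma]. *)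
Lemma pdhg_energy_ge (x x0 x1 : Z) (y y1 : Y) :
  tau^-1 / 2 * `|x1 - x| ^+ 2
  + (1 - omega * opnorm K ^+ 2 * tau * sigma) * (sigma^-1 / 2) * `|y1 - y| ^+ 2
  <= pdhg_energy x x0 x1 y y1.
Proof.
have := inner_linear_young (x1 - x0) (y1 - y) hK (_ : 0 < tau^-1).
rewrite invr_gt0 => /(_ htau); rewrite ler_norml => /andP[+ _].
rewrite -(ler_pM2l homega) invrK /pdhg_energy => h.
have -> : (1 - omega * opnorm K ^+ 2 * tau * sigma) * (sigma^-1 / 2) =
    sigma^-1 / 2 - omega * (opnorm K ^+ 2 * tau / 2).
  by field; apply: lt0r_neq0.
lra.
Qed.

Lemma pdhg_step (x x0 x1 x2 : Z) (y y1 y2 : Y) (gx g2 hy h2 : R) :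
  g2 + (tau^-1 * '[x1 - tau *: Kstar y2 - x2, x - x2]
        + gamma / 2 * `|x - x2| ^+ 2) <= gx ->
  h2 + (sigma^-1 * '[y1 + sigma *: K (x1 + theta *: (x1 - x0)) - y2, y - y2]
        + delta / 2 * `|y - y2| ^+ 2) <= hy ->
  (g2 + '[K x2, y] - hy) - (gx + '[K x, y2] - h2)
    + omega^-1 * pdhg_energy x x1 x2 y y2
  <= pdhg_energy x x0 x1 y y1.
Proof.
have htheta : 0 < theta by exact: lt_le_trans homegau.
pose d1 := x1 - x0; pose d2 := x2 - x1; pose e := x - x2.
pose w := y1 - y2; pose f := y - y2.
rewrite -/e -/f.
have -> : x1 - tau *: Kstar y2 - x2 = - (d2 + tau *: Kstar y2).
  by rewrite /d2 opprD opprB addrAC.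
have -> : '[- (d2 + tau *: Kstar y2), e] = - '[d2, e] - tau * '[K e, y2].
  by rewrite innerNl innerDl (innerZl tau) hKstar (innerC e) opprD.
have -> : y1 + sigma *: K (x1 + theta *: d1) - y2 =
    w + sigma *: (K x1 + theta *: K d1).
  by rewrite linearD linearZ /= /w addrAC.
rewrite innerDl (innerZl sigma) (innerDl (K x1)) (innerZl theta).
rewrite mulrBr mulrN (mulrDr sigma^-1) !(mulKf (lt0r_neq0 _)) //.
move=> Hg Hh.
rewrite /pdhg_energy -/d1 -/d2.
have -> : `|x2 - x| ^+ 2 = `|e| ^+ 2 by rewrite distrC.
have -> : `|y2 - y| ^+ 2 = `|f| ^+ 2 by rewrite distrC.
have -> : `|x1 - x| ^+ 2 = `|e| ^+ 2 + 2 * '[d2, e] + `|d2| ^+ 2.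
  by rewrite distrC -[x - x1](subrKA x2) sqr_normD (innerC d2).
have -> : `|y1 - y| ^+ 2 = `|w| ^+ 2 - 2 * '[w, f] + `|f| ^+ 2.
  by rewrite -sqr_normB /w /f opprB addrA addrNK.
have -> : '[K d2, y2 - y] = - '[K d2, f] by rewrite -opprB innerNr.
have -> : '[K d1, y1 - y] = '[K d1, w] - '[K d1, f].
  by rewrite -innerBr /w /f opprB addrA addrNK.
(* The term in [K x1] cancels against the one in [Hh], and the term in [K d2] against the coupling
   in the new energy. Only pairings with [K d1] remain to be estimated. *)
have EK : '[K x2, y] - '[K x, y2] + '[K e, y2] = '[K x1, f] + '[K d2, f].
  rewrite /e /f /d2 !(linearB K) !innerBl !innerBr; ring.
have /ler_normlP[Yw _] : `|'[K d1, w]|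
    <= (omega / theta / tau) / 2 * `|d1| ^+ 2
       + opnorm K ^+ 2 / (omega / theta / tau) / 2 * `|w| ^+ 2.
  by apply: inner_linear_young => //; rewrite !divr_gt0.
have /ler_normlP[Yf _] : `|'[K d1, f]|
    <= (omega / theta / tau) / 2 * `|d1| ^+ 2
       + opnorm K ^+ 2 / (omega / theta / tau) / 2 * `|f| ^+ 2.
  by apply: inner_linear_young => //; rewrite !divr_gt0.
(* The Young parameter [omega / theta / tau] is the one for which [hstep] yields this bound. *)
have cle : opnorm K ^+ 2 / (omega / theta / tau) <= omega^-1 * sigma^-1.
  have -> : opnorm K ^+ 2 / (omega / theta / tau) =
      theta * (opnorm K ^+ 2 * tau * sigma) * (omega^-1 * sigma^-1).
    by field; rewrite ?lt0r_neq0.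
  by rewrite ler_piMl // mulr_ge0 // invr_ge0 ltW.
have cle2 (v : Y) : opnorm K ^+ 2 / (omega / theta / tau) / 2 * `|v| ^+ 2
    <= omega^-1 * sigma^-1 / 2 * `|v| ^+ 2.
  by rewrite ler_wpM2r ?exprn_ge0 // ler_wpM2r.
(* [Yw] and [Yf] consume the shares [omega / theta] and [1 - omega / theta] of the square of [d1]
   stored in the old energy, hence all of it. *)
have {}Yw : - (omega * '[K d1, w]) <=
    omega / theta * (omega / tau / 2 * `|d1| ^+ 2)
    + sigma^-1 / 2 * `|w| ^+ 2.
  rewrite -mulrN; apply: (le_trans (ler_wpM2l (ltW homega) Yw)).
  apply: (le_trans (ler_wpM2l (ltW homega) (lerD (lexx _) (cle2 w)))).
  by rewrite le_eqVlt; apply/orP; left; apply/eqP; field; rewrite ?lt0r_neq0.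
have to0 : 0 <= theta - omega by rewrite subr_ge0.
have {}Yf : - ((theta - omega) * '[K d1, f]) <=
    (1 - omega / theta) * (omega / tau / 2 * `|d1| ^+ 2)
    + (theta - omega) * (omega^-1 * sigma^-1 / 2 * `|f| ^+ 2).
  rewrite -mulrN; apply: (le_trans (ler_wpM2l to0 Yf)).
  apply: (le_trans (ler_wpM2l to0 (lerD (lexx _) (cle2 f)))).
  by rewrite le_eqVlt; apply/orP; left; apply/eqP; field; rewrite ?lt0r_neq0.
(* Strong convexity of the primal function pays for the factor [omega^-1] on the new energy, by
   [hprimal]. *)
have Fe : omega^-1 * (tau^-1 / 2 * `|e| ^+ 2) <=
    (tau^-1 / 2 + gamma / 2) * `|e| ^+ 2.
  rewrite mulrA ler_wpM2r ?exprn_ge0 // mulrC ler_pdivrMr //.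
  have -> : (tau^-1 / 2 + gamma / 2) * omega =
      tau^-1 / 2 * (omega * (tau * gamma + 1)).
    by field; rewrite ?lt0r_neq0.
  by rewrite ler_peMr // divr_ge0 // invr_ge0 ltW.
(* On the dual side [1] comes from the new energy and [theta - omega] from [Yf]; their sum is what
   [hdual] allows. *)
have Ff : (theta - omega + 1) * (omega^-1 * sigma^-1 / 2 * `|f| ^+ 2) <=
    (sigma^-1 / 2 + delta / 2) * `|f| ^+ 2.
  rewrite mulrA ler_wpM2r ?exprn_ge0 //.
  have -> : (theta - omega + 1) * (omega^-1 * sigma^-1 / 2) =
      (theta - omega + 1) * (sigma^-1 / 2) / omega.
    by field; rewrite ?lt0r_neq0.
  rewrite ler_pdivrMr //.
  have -> : (sigma^-1 / 2 + delta / 2) * omega =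
      (omega * (sigma * delta + 1)) * (sigma^-1 / 2).
    by field; rewrite ?lt0r_neq0.
  rewrite ler_wpM2r ?divr_ge0 ?invr_ge0 ?(ltW hsigma) //.
  move: hdual; lra.
set A := `|e| ^+ 2 in Fe Hg *.
set B := `|f| ^+ 2 in Ff Yf Hh *.
set D := omega / tau / 2 * _ in Yf Yw.
have -> : omega * (tau^-1 / 2 * `|d1| ^+ 2) = D by rewrite /D; ring.
have -> : omega^-1 * (tau^-1 / 2 * A + sigma^-1 / 2 * B + omega * - '[K d2, f]
      + omega * (tau^-1 / 2 * `|d2| ^+ 2)) =
    omega^-1 * (tau^-1 / 2 * A) + omega^-1 * sigma^-1 / 2 * B - '[K d2, f]
      + tau^-1 / 2 * `|d2| ^+ 2.
  by field; rewrite ?lt0r_neq0.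
lra.
Qed.

Lemma pdhg_energy0 (x x0 : Z) (y y0 : Y) :
  pdhg_energy x x0 x0 y y0 =
    tau^-1 / 2 * `|x0 - x| ^+ 2 + sigma^-1 / 2 * `|y0 - y| ^+ 2.
Proof.
rewrite /pdhg_energy subrr linear0 linear0l normr0 expr0n /=; ring.
Qed.

Lemma pdhg_weighted_gap_le (G : Z -> \bar R) (H : Y -> \bar R)
    (xs : nat -> Z) (ys : nat -> Y) (xbars : nat -> Z) (g h : nat -> R)
    (x : Z) (y : Y) (gx hy : R) (N : nat) :
  proper_efun G -> convex_efun G -> strongly_convex gamma G ->
  proper_efun (conjugate H) -> convex_efun (conjugate H) ->
  strongly_convex delta (conjugate H) ->
  overrelaxed_pdhg G H K Kstar tau sigma theta xs ys xbars ->
  (forall n, G (xs n.+1) = (g n.+1)%:E) ->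
  (forall n, conjugate H (ys n.+1) = (h n.+1)%:E) ->
  G x = gx%:E -> conjugate H y = hy%:E ->
  (tau^-1 / 2 * `|xs N - x| ^+ 2
    + (1 - omega * opnorm K ^+ 2 * tau * sigma) * (sigma^-1 / 2)
      * `|ys N - y| ^+ 2)
  + \sum_(1 <= n < N.+1) omega ^+ N / omega ^+ n.-1 *
      ((g n + '[K (xs n), y] - hy) - (gx + '[K x, ys n] - h n))
  <= omega ^+ N *
      (tau^-1 / 2 * `|xs 0%N - x| ^+ 2 + sigma^-1 / 2 * `|ys 0%N - y| ^+ 2).
Proof.
move=> Gp Gc Gs Hp Hc Hs [xbar0 alg] Gg Hh Gx Hy.
(* Since [0.-1 = 0], the extrapolation vanishes at [n = 0], so one formula also covers the
   initialization. *)
have xbarE n : xbars n = xs n + theta *: (xs n - xs n.-1).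
  case: n => [|n] /=; first by rewrite subrr scaler0 addr0.
  by have [] := alg n.
rewrite addrC -(pdhg_energy0 x (xs 0%N)).
pose e n := pdhg_energy x (xs n.-1) (xs n) y (ys n).
pose gap n := (g n + '[K (xs n), y] - hy) - (gx + '[K x, ys n] - h n).
have step n : gap n.+1 + omega^-1 * e n.+1 <= e n.
  have [yprox xprox _] := alg n.
  have := prox_strongly_convex y Hp Hc Hs hsigma yprox.
  have := prox_strongly_convex x Gp Gc Gs htau xprox.
  rewrite Gg Hh Gx Hy -!EFinD !lee_fin xbarE => Hg Hd.
  exact: pdhg_step Hg Hd.
apply: le_trans (weighted_telescope N homega step).
by rewrite lerD2l pdhg_energy_ge.
Qed.

End OneStep.

(** * Both estimates at arbitrary comparison points, finite or not *)

Theorem theorem1 (R : realType) (Z Y : finHilbertType R)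
  (K : {linear Z -> Y}) (Kstar : {linear Y -> Z})
  (hKstar : is_adjoint K Kstar) (hK : 0 < opnorm K)
  (G : Z -> \bar R) (H : Y -> \bar R)
  (hGp : proper_efun G) (hGc : convex_efun G) (hGl : lower_semicontinuous G)
  (hHp : proper_efun H) (hHc : convex_efun H) (hHl : lower_semicontinuous H)
  (gamma delta : R) (hgamma : 0 < gamma) (hdelta : 0 < delta)
  (hGs : strongly_convex gamma G)
  (hHs : strongly_convex delta (conjugate H))
  (xistar : Z) (ystar : Y)
  (hsaddle : saddle_point (lagrangian G H K) xistar ystar)
  (tau sigma theta : R) (htau : 0 < tau) (hsigma : 0 < sigma)
  (htheta : 0 < theta <= 1)
  (hthetal : Num.max (1 / (tau * gamma + 1)) (1 / (sigma * delta + 1)) <= theta)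
  (hthetau : theta <= 1 / (opnorm K ^+ 2 * tau * sigma))
  (xis : nat -> Z) (ys : nat -> Y) (xibars : nat -> Z)
  (halg : overrelaxed_pdhg G H K Kstar tau sigma theta xis ys xibars)
  (omega : R)
  (homegal : Num.max (1 / (tau * gamma + 1))
                     ((theta + 1) / (sigma * delta + 2)) <= omega)
  (homegau : omega <= theta) :
  let L := lagrangian G H K in
  (forall (N : nat) (xi : Z) (y : Y),
    ((1 / (2 * tau) * `|xis N - xi| ^+ 2
      + (1 - omega * opnorm K ^+ 2 * tau * sigma) * (1 / (2 * sigma))
        * `|ys N - y| ^+ 2)%:E
     + \sum_(1 <= n < N.+1) (omega ^+ N / omega ^+ n.-1)%:E
                            * (L (xis n) y - L xi (ys n))
     <= (omega ^+ N / (2 * tau) * `|xis 0%N - xi| ^+ 2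
         + omega ^+ N / (2 * sigma) * `|ys 0%N - y| ^+ 2)%:E)%E)
  /\
  (forall N : nat, (1 <= N)%N ->
    let T := weight_sum omega N in
    T = (if omega == 1 then N%:R
         else (1 - omega ^+ N) / (omega ^+ N.-1 * (1 - omega))) /\
    forall (xi : Z) (y : Y),
    ((ergodic_factor omega N * (1 / (2 * tau)) * `|xi - xis N| ^+ 2
      + ergodic_factor omega N * (1 - omega * opnorm K ^+ 2 * tau * sigma)
        * (1 / (2 * sigma)) * `|y - ys N| ^+ 2)%:E
     + (L (ergodic_average omega N xis) y - L xi (ergodic_average omega N ys))
     <= (1 / T * (1 / (2 * tau)) * `|xi - xis 0%N| ^+ 2
         + 1 / T * (1 / (2 * sigma)) * `|y - ys 0%N| ^+ 2)%:E)%E).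
Proof.
have [theta0 theta1] := andP htheta.
have [wtau wdual] : 1 / (tau * gamma + 1) <= omega /\
    (theta + 1) / (sigma * delta + 2) <= omega.
  by move: homegal; rewrite ge_max => /andP[].
have tg0 : 0 < tau * gamma + 1 by rewrite addr_gt0 ?mulr_gt0.
have sd0 : 0 < sigma * delta + 2 by rewrite addr_gt0 ?mulr_gt0.
have w0 : 0 < omega by apply: lt_le_trans wtau; rewrite divr_gt0.
have w1 : omega <= 1 by exact: le_trans homegau theta1.
have hprimal : 1 <= omega * (tau * gamma + 1) by rewrite -ler_pdivrMr.
have hdual : theta + 1 <= omega * (sigma * delta + 2) by rewrite -ler_pdivrMr.
have hstep : theta * (opnorm K ^+ 2 * tau * sigma) <= 1.
  by rewrite -ler_pdivlMr // !mulr_gt0 // exprn_gt0.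
have Et : 1 / (2 * tau) = tau^-1 / 2 by rewrite div1r invfM mulrC.
have Es : 1 / (2 * sigma) = sigma^-1 / 2 by rewrite div1r invfM mulrC.
have Hc : convex_efun (conjugate H) by exact: convex_conjugate.
have HNy := conjugate_neqNy hHp.
have [_ alg] := halg.
pose g n := fine (G (xis n)); pose h n := fine (conjugate H (ys n)).
have Gg n : G (xis n.+1) = (g n.+1)%:E.
  by have [_ xprox _] := alg n; rewrite fineK // (prox_fin_num hGp xprox).
have Hh : proper_efun (conjugate H) ->
    forall n, conjugate H (ys n.+1) = (h n.+1)%:E.
  move=> Hp n; have [yprox _ _] := alg n.
  by rewrite fineK // (prox_fin_num Hp yprox).
pose L := lagrangian G H K.
(* Either both function values at [(xi, y)] are real, which also makes [conjugate H] proper, or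
   every gap with a positive index is [-oo]. *)
have gap_cases (xi : Z) (y : Y) :
    [/\ proper_efun (conjugate H), exists gx, G xi = gx%:E &
        exists hy, conjugate H y = hy%:E] \/
    (forall n, L (xis n.+1) y - L xi (ys n.+1) = -oo)%E /\
    (forall N, (1 <= N)%N ->
      L (ergodic_average omega N xis) y
        - L xi (ergodic_average omega N ys) = -oo)%E.
  case Hy : (conjugate H y) => [hy| |]; last by move: (HNy y); rewrite Hy.
    have Hp : proper_efun (conjugate H) by split=> //; exists y; rewrite Hy.
    case Gx : (G xi) => [gx| |]; last by have [/(_ xi)] := hGp; rewrite Gx.
      by left; split; [|exists gx|exists hy].
    right; split=> [n|N N1]; apply: lagrangian_gapNy; right; split=> //.
      by rewrite Hh.
    (* Jensen's inequality keeps the dual average in the domain of [conjugate H], which excludes the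
       ambiguous difference of infinities. *)
    have := convex_ergodic_average_le w0 N1 Hc (Hh Hp).
    by case: (conjugate H _).
  by right; split=> [n|N N1]; apply: lagrangian_gapNy; left.
pose gap xi y gx hy n :=
  (g n + '[K (xis n), y] - hy) - (gx + '[K xi, ys n] - h n).
have bound (xi : Z) (y : Y) (gx hy : R) (N : nat) :
    proper_efun (conjugate H) -> G xi = gx%:E -> conjugate H y = hy%:E ->
    (tau^-1 / 2 * `|xis N - xi| ^+ 2
      + (1 - omega * opnorm K ^+ 2 * tau * sigma) * (sigma^-1 / 2)
        * `|ys N - y| ^+ 2)
    + \sum_(1 <= n < N.+1) omega ^+ N / omega ^+ n.-1 * gap xi y gx hy n
    <= omega ^+ N *
       (tau^-1 / 2 * `|xis 0%N - xi| ^+ 2 + sigma^-1 / 2 * `|ys 0%N - y| ^+ 2).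
  move=> Hp Gx Hy.
  exact: (pdhg_weighted_gap_le hKstar hK htau hsigma w0 homegau hprimal hdual
            hstep N hGp hGc hGs Hp Hc hHs halg Gg (Hh Hp) Gx Hy).
move=> L0; split=> [N xi y|N N1 T]; last first.
  split=> [|xi y]; first exact: weight_sumE.
  have [[Hp [gx Gx] [hy Hy]]|[_ /(_ _ N1) ->]] := gap_cases xi y; last first.
    by rewrite addeNy leNye.
  have T0 : 0 < T := weight_sum_gt0 w0 N1.
  have avg := ergodic_lagrangian_gap_le K w0 N1 hGc Hc Gg (Hh Hp) Gx Hy.
  apply: le_trans (leeD2l _ avg) _.
  rewrite -EFinD lee_fin ergodic_factorE ?w0 // Et Es !(distrC xi) !(distrC y).
  have wN0 : 0 < omega ^+ N by rewrite exprn_gt0.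
  have wT0 : 0 < (omega ^+ N * T)^-1 by rewrite invr_gt0 mulr_gt0.
  (* Part (ii) is part (i) multiplied by the inverse of [omega ^+ N * T]. *)
  have := bound xi y gx hy N Hp Gx Hy; rewrite -(ler_pM2l wT0).
  have -> : \sum_(1 <= n < N.+1) omega ^+ N / omega ^+ n.-1 * gap xi y gx hy n =
      omega ^+ N * \sum_(1 <= n < N.+1) 1 / omega ^+ n.-1 * gap xi y gx hy n.
    by rewrite mulr_sumr; apply: eq_bigr => n _; rewrite div1r mulrA.
  rewrite -/T; set S := \sum_(1 <= n < N.+1) _.
  congr (is_true (_ <= _)); by field; rewrite ?lt0r_neq0.
have [[Hp [gx Gx] [hy Hy]]|[gapNy _]] := gap_cases xi y.
  have -> : (\sum_(1 <= n < N.+1) (omega ^+ N / omega ^+ n.-1)%:E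
        * (L0 (xis n) y - L0 xi (ys n)) =
      (\sum_(1 <= n < N.+1)
         omega ^+ N / omega ^+ n.-1 * gap xi y gx hy n)%:E)%E.
    rewrite -sumEFin; apply: eq_big_nat => -[//|n] _; rewrite EFinM.
    by rewrite (lagrangian_gapE K (Gg n) Gx (Hh Hp n) Hy).
  rewrite -EFinD lee_fin Et Es; apply: le_trans (bound xi y gx hy N Hp Gx Hy) _.
  by rewrite le_eqVlt; apply/orP; left; apply/eqP; field; rewrite ?lt0r_neq0.
(* For [N = 0] the sum is empty and offers no [-oo]; the bound is then [pdhg_energy_ge] without
   extrapolation. Otherwise the last summand is a positive multiple of [-oo] and absorbs the
   left-hand side. *)
case: N => [|N].
  rewrite big_nil adde0 lee_fin expr0 Et Es.
  have := pdhg_energy_ge hK htau hsigma w0 xi (xis 0%N) (xis 0%N) y (ys 0%N).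
  by rewrite pdhg_energy0.
rewrite big_nat_recr //= gapNy gt0_muleNy ?lte_fin ?divr_gt0 ?exprn_gt0 //.
by rewrite !addeNy leNye.
Qed.
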